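(* Every connected graph $G$ with no triangle and no induced $T_{123}$ satisfies at least one of the following: (1) $G$ contains no induced path on 8 vertices; (2) $G$ is an extension of a cycle or of a path; (3) $G$ admits a bipartite 2-join.
   Context: $T_{123}$ is the tree on vertices $a,b,c,d,e,f,g$ with edges $ab,ac,cd,ae,ef,fg$. A partition $(X_1,X_2)$ of $V(G)$ is a 2-join if there exist disjoint $A_1,B_1\subseteq X_1$ and disjoint $A_2,B_2\subseteq X_2$ such that every vertex of $A_1$ is adjacent to every vertex of $A_2$, every vertex of $B_1$ is adjacent to every vertex of $B_2$, and there are no other edges between $X_1$ and $X_2$. It is a bipartite 2-join if moreover: $A_1\cup B_1\neq\emptyset$; $A_2\neq\emptyset$, $B_2\neq\emptyset$ and $X_2=A_2\cup B_2$; $|X_2|\ge 3$; $A_2$ and $B_2$ are stable sets; and $G[X_2]$ has at least one edge. An extension of a graph $H$ is any graph obtained by replacing each vertex $x$ of $H$ by a (possibly empty) stable set $S_x$, where $S_x$ and $S_y$ are completely joined if $xy\in E(H)$ and there are no edges between them otherwise. *)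

(* Defs.v *)
From mathcomp Require Import all_boot.
Set Implicit Arguments.
Unset Strict Implicit.
Unset Printing Implicit Defensive.

Record sgraph := SGraph {
  vertex :> finType;
  adj : rel vertex;
  adj_sym : symmetric adj;
  adj_irrefl : irreflexive adj
}.

(* The empty graph counts as connected under this definition. *)
Definition connected (G : sgraph) : Prop :=
  forall x y : G, connect (@adj G) x y.

Definition triangle_free (G : sgraph) : Prop :=
  ~ exists x y z : G, [/\ adj x y, adj y z & adj x z].

Definition contains_induced (G H : sgraph) : Prop :=
  exists2 f : H -> G, injective f & forall x y : H, adj (f x) (f y) = adj x y.

Section VertexSets.
Variable G : sgraph.
Implicit Types A B X : {set G}.

Definition stable A : Prop := {in A &, forall x y : G, ~~ adj x y}.

Definition complete A B : Prop := {in A & B, forall x y : G, adj x y}.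

Definition anticomplete A B : Prop := {in A & B, forall x y : G, ~~ adj x y}.

Record two_join_with X1 X2 A1 B1 A2 B2 : Prop := TwoJoinWith {
  tj_cover : X1 :|: X2 = setT;
  tj_disjoint : [disjoint X1 & X2];
  tj_A1 : A1 \subset X1;
  tj_B1 : B1 \subset X1;
  tj_disjoint1 : [disjoint A1 & B1];
  tj_A2 : A2 \subset X2;
  tj_B2 : B2 \subset X2;
  tj_disjoint2 : [disjoint A2 & B2];
  tj_completeA : complete A1 A2;
  tj_completeB : complete B1 B2;
  tj_no_other_edge : forall x1 x2 : G, x1 \in X1 -> x2 \in X2 -> adj x1 x2 ->
    x1 \in A1 /\ x2 \in A2 \/ x1 \in B1 /\ x2 \in B2
}.

Record bipartite_two_join_with X1 X2 A1 B1 A2 B2 : Prop :=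
  BipartiteTwoJoinWith {
  btj_two_join : two_join_with X1 X2 A1 B1 A2 B2;
  btj_AB1_nonempty : A1 :|: B1 != set0;
  btj_A2_nonempty : A2 != set0;
  btj_B2_nonempty : B2 != set0;
  btj_X2 : X2 = A2 :|: B2;
  btj_card_X2 : 3 <= #|X2|;
  btj_stable_A2 : stable A2;
  btj_stable_B2 : stable B2;
  btj_edge_X2 : exists x y : G, [/\ x \in X2, y \in X2 & adj x y]
}.

Definition has_bipartite_two_join : Prop :=
  exists X1 X2 A1 B1 A2 B2 : {set G},
    bipartite_two_join_with X1 X2 A1 B1 A2 B2.

End VertexSets.

(* Some of the sets S x may be empty. *)
Record extension_by (G H : sgraph) (S : H -> {set G}) : Prop := ExtensionBy {
  ext_cover : \bigcup_(x : H) S x = setT;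
  ext_disjoint : forall x y : H, x != y -> [disjoint S x & S y];
  ext_stable : forall x : H, stable (S x);
  ext_complete : forall x y : H, adj x y -> complete (S x) (S y);
  ext_anticomplete :
    forall x y : H, x != y -> ~~ adj x y -> anticomplete (S x) (S y)
}.

Definition is_extension_of (G H : sgraph) : Prop :=
  exists S : H -> {set G}, extension_by S.

Definition path_adj (n : nat) : rel 'I_n :=
  fun i j => (i.+1 == j :> nat) || (j.+1 == i :> nat).

Lemma path_adj_sym n : symmetric (@path_adj n).
Proof. by move=> i j; rewrite /path_adj orbC. Qed.

Lemma path_adj_irrefl n : irreflexive (@path_adj n).
Proof. by move=> i; rewrite /path_adj orbb gtn_eqF. Qed.

Definition path_graph (n : nat) : sgraph :=
  SGraph (@path_adj_sym n) (@path_adj_irrefl n).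

(* The cycle C_n only for 3 <= n; the test i != j removes the loop at n = 1. *)
Definition cycle_adj (n : nat) : rel 'I_n :=
  fun i j => (i != j) && ((i.+1 %% n == j) || (j.+1 %% n == i)).

Lemma cycle_adj_sym n : symmetric (@cycle_adj n).
Proof. by move=> i j; rewrite /cycle_adj eq_sym orbC. Qed.

Lemma cycle_adj_irrefl n : irreflexive (@cycle_adj n).
Proof. by move=> i; rewrite /cycle_adj eqxx. Qed.

Definition cycle_graph (n : nat) : sgraph :=
  SGraph (@cycle_adj_sym n) (@cycle_adj_irrefl n).

(* The vertices a, b, c, d, e, f, g are numbered 0, 1, 2, 3, 4, 5, 6, so that
   the edges ab, ac, cd, ae, ef, fg become the pairs below. *)
Definition T123_edges : seq (nat * nat) :=
  [:: (0, 1); (0, 2); (2, 3); (0, 4); (4, 5); (5, 6)].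

Definition T123_adj : rel 'I_7 :=
  fun i j => ((i : nat, j : nat) \in T123_edges)
             || ((j : nat, i : nat) \in T123_edges).

Lemma T123_adj_sym : symmetric T123_adj.
Proof. by move=> i j; rewrite /T123_adj orbC. Qed.

Lemma T123_adj_irrefl : irreflexive T123_adj.
Proof. by case=> [] [|[|[|[|[|[|[|m]]]]]]]. Qed.

Definition T123 : sgraph := SGraph T123_adj_sym T123_adj_irrefl.

(* Main.v *)
Require Import Defs.
From mathcomp Require Import all_boot zify.

(** Let p be a longest induced path, with k >= 8 vertices.  Excluding T123
    forces the neighbours of any vertex v on p to be: none, those of a vertex
    of p, the two ends of p (v closes a hole of length k + 1), or all vertices
    of one parity; a single end is impossible as p is longest.  Let S_i be the
    set of vertices whose trace on p is that of the vertex i of the cycle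
    C_(k + 1) with vertices 0, .., k, where p_i is vertex i and S_k consists of
    the vertices closing a hole.  Since p_i can be exchanged with any vertex of
    S_i, the union of the S_i induces an extension of C_(k + 1) (with S_k
    possibly empty), a vertex without neighbour on p has none in this union,
    and a vertex adjacent to one parity class of p is complete to the
    corresponding S_i and anticomplete to the others.  If there is a vertex of
    the last kind, the even and the odd S_i form the sides of a bipartite
    2-join; otherwise, by connectivity, the S_i cover G. *)

Set Implicit Arguments.
Unset Strict Implicit.
Unset Printing Implicit Defensive.

(** * Possible traces of a vertex on an induced path *)

Definition T123_nat (i j : nat) : bool :=
  ((i, j) \in T123_edges) || ((j, i) \in T123_edges).

Definition ladj (i j : nat) : bool := (i.+1 == j) || (j.+1 == i).

(* The vertex [k] is the additional vertex, with trace [N] on the path [0, .., k - 1]. *)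
Definition path1_adj (k : nat) (N : pred nat) (i j : nat) : bool :=
  if i == k then (j != k) && N j else if j == k then N i else ladj i j.

Definition T123_at (E : rel nat) (t : seq nat) : bool :=
  all (fun i => all (fun j => E (nth 0 t i) (nth 0 t j) == T123_nat i j) (iota 0 7)) (iota 0 7).

(* Each trace on an 8-vertex path that is to be excluded produces a copy of T123, with vertices listed in the order a, .., g, at one of these positions. *)
Definition T123_witnesses : seq (seq nat) :=
  [:: [:: 2; 1; 3; 4; 8; 7; 6]; [:: 3; 8; 2; 1; 4; 5; 6];
      [:: 4; 8; 5; 6; 3; 2; 1]; [:: 1; 0; 2; 3; 8; 7; 6];
      [:: 5; 8; 6; 7; 4; 3; 2]; [:: 6; 7; 5; 4; 8; 0; 1];
      [:: 2; 8; 1; 0; 3; 4; 5]; [:: 8; 7; 5; 4; 0; 1; 2];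
      [:: 6; 7; 5; 4; 8; 1; 2]; [:: 5; 4; 6; 7; 8; 2; 1];
      [:: 4; 3; 5; 6; 8; 0; 1]; [:: 3; 4; 8; 7; 2; 1; 0];
      [:: 3; 4; 8; 6; 2; 1; 0]; [:: 8; 0; 3; 2; 5; 6; 7];
      [:: 8; 3; 1; 0; 7; 6; 5]; [:: 8; 3; 1; 0; 5; 6; 7];
      [:: 8; 0; 6; 7; 4; 3; 2]; [:: 4; 3; 8; 1; 5; 6; 7];
      [:: 1; 0; 2; 3; 8; 6; 7]; [:: 8; 7; 4; 5; 2; 1; 0];
      [:: 2; 3; 1; 0; 8; 6; 5]].

Definition mask_clean (N : pred nat) : bool :=
  all (fun i => ~~ (N i && N i.+1)) (iota 0 7) &&
  all (fun t => ~~ T123_at (path1_adj 8 N) t) T123_witnesses.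

(* The shape [J] is empty for [J = 0], and otherwise the neighbourhood in the path of its vertex [J - 2], where the path is thought of as extended by one vertex at each end. *)
Definition twin_trace (J x : nat) : bool := (x + 3 == J) || (x.+1 == J).

Definition good_trace (k : nat) (N : pred nat) : Prop :=
  [\/ exists J, forall x, x < k -> N x = twin_trace J x,
      forall x, x < k -> N x = (x == 0) || (x.+1 == k)
    | exists b, forall x, x < k -> N x = (odd x == b)].

(** Both sides depend only on [N 0], .., [N 7], so this is a finite check over 256 traces. *)
Lemma mask_clean_good (N : pred nat) : mask_clean N -> good_trace 8 N.
Proof.
pose good_b (M : pred nat) := [|| has (fun J => all (fun x => M x == twin_trace J x) (iota 0 8)) (iota 0 11),
   all (fun x => M x == (x == 0) || (x.+1 == 8)) (iota 0 8) |
   has (fun b => all (fun x => M x == (odd x == b)) (iota 0 8)) [:: true; false]].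
have all8 (f g : pred nat) : all (fun x => f x == g x) (iota 0 8) -> forall x, x < 8 -> f x = g x.
  by move=> /allP h x x8; apply/eqP/h; rewrite mem_iota.
move=> cN; suff /or3P[/hasP[J _ h] | h | /hasP[b _ h]] : good_b N.
- by constructor 1; exists J; apply: all8.
- by constructor 2; apply: all8.
- by constructor 3; exists b; apply: all8.
pose s := mkseq N 8.
have Ns x : x < 8 -> N x = nth false s x by move=> x8; rewrite nth_mkseq.
have good_ext (M M' : pred nat) : (forall x, x < 8 -> M x = M' x) -> good_b M = good_b M'.
  by move=> e; rewrite /good_b /= !e.
have clean_ext (M M' : pred nat) : (forall x, x < 8 -> M x = M' x) -> mask_clean M = mask_clean M'.
  by move=> e; rewrite /mask_clean /= /T123_at /path1_adj /= !e.
rewrite (good_ext _ _ Ns); move: cN; rewrite (clean_ext _ _ Ns) /s /mkseq /=.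
by case: (N 0); case: (N 1); case: (N 2); case: (N 3); case: (N 4);
   case: (N 5); case: (N 6); case: (N 7); vm_compute.
Qed.

(** Deleting the last or the first of the [k + 1] vertices leaves two good traces overlapping in at
    least 7 positions. As no two consecutive positions are marked, they glue to a good trace, apart
    from {1, k} and its mirror image {0, k - 1}, which the last two hypotheses exclude. *)
Lemma good_trace_step (k : nat) (N : pred nat) : 8 <= k ->
    good_trace k N -> good_trace k (fun x => N x.+1) ->
    (forall x, x < k -> ~~ (N x && N x.+1)) ->
    ~ (forall x, x <= k -> N x = (x == 1) || (x == k)) ->
    ~ (forall x, x <= k -> N x = (x == 0) || (x.+1 == k)) ->
  good_trace k.+1 N.
Proof.
rewrite /good_trace /twin_trace => k8 [[J h]|h|[b h]] tail st kill1 kill2; last first.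
- constructor 3; exists b => x xk; have [xk'|xk'] := ltnP x k; first exact: h.
  have {xk xk'}-> : x = k by lia.
  (* The tail reads the same alternation shifted by one: positions 1 to 6 rule out its other shapes,
     and its parity, opposite to [b], fixes [N k]. *)
  have [[h1 h2 h3] [h4 h5 h6]] : [/\ N 1 = b, N 2 = ~~ b & N 3 = b] /\ [/\ N 4 = ~~ b, N 5 = b & N 6 = ~~ b].
    by do 2 split; rewrite h; try lia; case: (b).
  case: tail => [[J t]|t|[b' t]].
  + have := t 0 ltac:(lia); have := t 1 ltac:(lia); have := t 2 ltac:(lia); have := t 3 ltac:(lia).
    by have := t 4 ltac:(lia); have := t 5 ltac:(lia); rewrite h1 h2 h3 h4 h5 h6 /twin_trace; case: (b); lia.
  + by have := t 1 ltac:(lia); have := t 2 ltac:(lia); rewrite h2 h3; case: (b); lia.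
  + have := t 0 ltac:(lia); rewrite h1 /= => bb'.
    have := t k.-1 ltac:(lia); rewrite prednK; last lia. move=> ->.
    by move: bb'; case: (b'); case: (b) => //= _; lia.
- case: kill2 => x xk; have [xk'|xk'] := ltnP x k; first exact: h.
  have {xk xk'}-> : x = k by lia.
  by have := st k.-1 ltac:(lia); rewrite prednK; [rewrite h; lia | lia].
have dich : N k = (k + 3 == J) || (k.+1 == J) \/ N k = ~~ ((k + 3 == J) || (k.+1 == J)).
  by case: (N k); case: (_ || _); auto.
(* Several indices have the same trace below [k] (0 and [k + 3] both give the empty one), so [J] may
   be renamed to fit the value at [k]. *)
have ext J' : (forall x, x < k -> (x + 3 == J) || (x.+1 == J) = (x + 3 == J') || (x.+1 == J')) ->
    N k = (k + 3 == J') || (k.+1 == J') -> good_trace k.+1 N.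
  move=> e eN; constructor 1; exists J' => x xk; have [xk'|xk'] := ltnP x k; first by rewrite h ?e.
  by have -> : x = k by lia.
have [Nk|tailk] := dich; first by apply: (ext J).
case: tail => [[J' t]|t|[b' t]].
- have [J0|J0] := boolP ((J == 0) || (k + 4 <= J)).
    by apply: (ext (k + 3)) => [x xk|]; lia.
  have [J1|J1] := eqVneq J (k + 3).
    by apply: (ext 0) => [x xk|]; lia.
  have tk := t k.-1 ltac:(lia); rewrite prednK in tk; last lia.
  have [J2|J2] := eqVneq J k.+1.
    exfalso; have [m km] : exists m, k = m.+4.+4 by exists (k - 8); lia.
    have := t m.+4.+1 ltac:(lia); have := t m.+3 ltac:(lia).
    by rewrite !h; move: tk tailk; clear -J2 km; subst; lia.
  have {}tailk : N k by lia.
  have [J3|J3] := eqVneq J k.+2.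
    by exfalso; have := st k.-1 ltac:(lia); rewrite prednK; [rewrite tailk h; lia | lia].
  have [J4|J4] := eqVneq J 1.
    constructor 2 => x xk; have [xk'|xk'] := ltnP x k; first by rewrite h //; lia.
    by rewrite (_ : x = k) ?tailk; lia.
  have [J5|J5] := eqVneq J 2.
    case: kill1 => x xk; have [xk'|xk'] := ltnP x k; first by rewrite h //; lia.
    by rewrite (_ : x = k) ?tailk; lia.
  (* Now [j], [j + 2] and [k] are marked. The tail keeps [j + 2] and [k], so these are at distance
     at most 2: at distance 2, [j = k - 4] is a third mark of the tail; at distance 1, two
     consecutive vertices are marked. *)
  exfalso; have [j Jj] : exists j, J = j.+3 by exists (J - 3); lia.
  have [m km] : exists m, k = m.+4.+4 by exists (k - 8); lia.
  have JJ : J' = j.+4 \/ J' = j.+2.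
    by move: (t j.+1 ltac:(lia)); rewrite h; [clear -Jj; subst; lia | lia].
  have Jk : J' = k \/ J' = k.+2 by move: tk; rewrite tailk; clear -k8; lia.
  have [] : j.+4 = k \/ j.+3 = k by clear -J0 J1 J2 J3 Jj JJ Jk; lia.
    by move: (t m.+3 ltac:(lia)); rewrite h; [clear -Jj km JJ Jk; subst; lia | lia].
  by have := st k.-1 ltac:(lia); rewrite prednK; [rewrite tailk h; lia | lia].
- case: kill1 => x xk.
  have t0 := t 0 ltac:(lia); have t2 := t 2 ltac:(lia).
  have h1 := h 1 ltac:(lia); have h3 := h 3 ltac:(lia).
  have [xk'|xk'] := ltnP x k; first by rewrite h //; lia.
  have {xk xk'}-> : x = k by lia.
  by have := t k.-1 ltac:(lia); rewrite prednK; lia.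
(* A twin trace has at most two marks, while a parity class has three among positions 1 to 6. *)
- have {}h x : x < 6 -> (x.+1 + 3 == J) || (x.+2 == J) = (odd x == b').
    by move=> x6; rewrite -t ?h; lia.
  move: (h 0 isT) (h 1 isT) (h 2 isT) (h 3 isT) (h 4 isT) (h 5 isT).
  clear; case: b' => t0 t1 t2 t3 t4 t5.
    have J2 : J = 5 \/ J = 3 by clear -t1; lia.
    have J6 : J = 9 \/ J = 7 by clear -t5; lia.
    by lia.
  have J1 : J = 4 \/ J = 2 by clear -t0; lia.
  have J5 : J = 8 \/ J = 6 by clear -t4; lia.
  by lia.
Qed.

(** * Traces as neighbourhoods in the cycle on 0, .., k *)

Definition cadj (k i j : nat) : bool :=
  [|| ladj i j, (i == k) && (j == 0) | (j == k) && (i == 0)].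

Lemma cycle_adjE (k : nat) (i j : 'I_k.+1) :
  2 <= k -> cycle_adj i j = cadj k i j.
Proof.
move=> k2; rewrite /cycle_adj /cadj /ladj -val_eqE /=.
have mE (x : 'I_k.+1) : x.+1 %% k.+1 = if x == k :> nat then 0 else x.+1.
  have [->|xk] := eqVneq; first by rewrite modnn.
  by rewrite modn_small //; have := ltn_ord x; lia.
rewrite !mE; have := ltn_ord i; have := ltn_ord j.
by do 2 case: ifP; lia.
Qed.

(** What remains of [good_trace] for a longest path: a single end is gone, and the two ends together
    are the neighbours of the cycle vertex [k]. *)
Definition cycle_trace (k : nat) (N : pred nat) : Prop :=
  [\/ forall x, x < k -> N x = false,
      exists2 j, j <= k & forall x, x < k -> N x = cadj k j x
    | exists b, forall x, x < k -> N x = (odd x == b)].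

Section CycleTrace.
Variables (k : nat) (M : pred nat).
Hypotheses (k8 : 8 <= k) (kM : cycle_trace k M).

(** The consecutive non-neighbours [c] and [c + 1] rule out the parity shape; two neighbours of a
    cycle vertex are at cyclic distance 2. *)
Lemma cycle_trace_pair c a b :
    c.+1 < k -> M c = false -> M c.+1 = false ->
    a < b -> b < k -> M a -> M b ->
  b = a.+2 \/ a = 0 /\ b.+1 = k.
Proof.
rewrite /cadj /ladj => ck Mc Mc1 ab bk; case: kM => [h|[j jk h]|[b' h]].
- by rewrite h //; lia.
- by rewrite !h; rewrite /cadj /ladj; lia.
- by move: Mc Mc1; rewrite !h; case: (b'); lia.
Qed.

(** Only the cycle vertices 0 and [k - 1] have a neighbour, [k], off the path; their lone marks are
    1 and [k - 2]. Any other mark has a partner. *)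
Lemma cycle_trace_single c a :
    c.+1 < k -> M c = false -> M c.+1 = false -> a < k -> M a ->
    a <> 1 -> a.+2 <> k ->
  exists2 b, b < k & M b /\ [\/ b = a.+2, a = b.+2, a = 0 /\ b.+1 = k | b = 0 /\ a.+1 = k].
Proof.
move=> ck Mc Mc1 ak; case: kM => [h|[j jk h]|[b' h]]; first by rewrite h.
  rewrite h // /cadj /ladj => aj a1 a2.
  have [aj1|ja1] : a = j.+1 \/ a < j by lia.
    exists j.-1; last rewrite h /cadj /ladj; try lia.
    by split; [lia | constructor 2; lia].
  have [jk'|jk'] := ltnP j k.
    exists j.+1; first by lia.
    by rewrite h /cadj /ladj; [split; [lia | constructor 1; lia] | lia].
  have [a0|a0] := eqVneq a 0.
    by exists k.-1; [lia | rewrite h /cadj /ladj; [split; [lia | constructor 3; lia] | lia]].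
  by exists 0; [lia | rewrite h /cadj /ladj; [split; [lia | constructor 4; lia] | lia]].
by move: Mc Mc1; rewrite !h; case: (b'); lia.
Qed.

(** In a cycle of length at least 9, two vertices at distance 4 have no common neighbour. *)
Lemma cycle_trace_parity a :
  a + 4 < k -> M a -> M (a + 4) -> exists b, forall x, x < k -> M x = (odd x == b).
Proof.
move=> ak; case: kM => [h|[j jk h]|//]; first by rewrite h; lia.
by rewrite !h /cadj /ladj; lia.
Qed.

End CycleTrace.

(** Here [e] stands for the adjacency of u in S_i and w in S_j. The hypotheses are the traces of w
    once u replaces p_i, and of u once w replaces p_j; a wrong [e] spoils one of them. *)
Lemma swap_trace (k i j : nat) (e : bool) : 8 <= k -> i < j -> j <= k ->
    cycle_trace k (fun x => if x == i then e else cadj k j x) ->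
    (j < k -> cycle_trace k (fun x => if x == j then e else cadj k i x)) ->
  e = cadj k i j.
Proof.
move=> k8 ij jk.
set M := fun x => _; set M' := fun x => _ => kM kM'.
have ik : i < k by lia.
have ME x : x != i -> x < k -> M x = [|| x.+1 == j, x == j.+1 | (j == k) && (x == 0)].
  by rewrite /M /cadj /ladj => /negPf-> xk; lia.
have M'E x : x != j -> x < k -> M' x = (x.+1 == i) || (x == i.+1).
  by rewrite /M' /cadj /ladj => /negPf-> xk; lia.
have Mi : M i = e by rewrite /M eqxx.
have M'j : M' j = e by rewrite /M' eqxx.
(* Only [i] and the at most two neighbours of [j] can be marked, so one of the disjoint pairs 01,
   23, 45, 67 is unmarked. *)
have [c [ck Mc Mc1]] : exists c, [/\ c.+1 < k, M c = false & M c.+1 = false].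
  pose ok c := [&& c != i, c.+1 != i, c.+1 != j, c.+2 != j, c != j.+1, c != j & (j != k) || (c != 0)].
  suff [c c7 okc] : exists2 c, c < 7 & ok c.
    by exists c; rewrite !ME; move: okc; rewrite /ok; try split; lia.
  have [o0|o0] := boolP (ok 0); first by exists 0.
  have [o2|o2] := boolP (ok 2); first by exists 2.
  have [o4|o4] := boolP (ok 4); first by exists 4.
  by exists 6 => //; move: o0 o2 o4; rewrite /ok; clear -k8 ij jk; lia.
have pairM := cycle_trace_pair k8 kM ck Mc Mc1.
have singM := cycle_trace_single k8 kM ck Mc Mc1.
have [c' [ck' Mc' Mc1']] : exists c, [/\ c.+1 < k, M' c = false & M' c.+1 = false].
  pose ok c := [&& c != j, c.+1 != j, c.+1 != i, c.+2 != i, c != i.+1 & c != i].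
  suff [d d7 okd] : exists2 c, c < 7 & ok c.
    by exists d; rewrite !M'E; move: okd; rewrite /ok; try split; lia.
  have [o0|o0] := boolP (ok 0); first by exists 0.
  have [o2|o2] := boolP (ok 2); first by exists 2.
  have [o4|o4] := boolP (ok 4); first by exists 4.
  by exists 6 => //; move: o0 o2 o4; rewrite /ok; clear -k8 ij jk; lia.
have pairM' jk' := cycle_trace_pair k8 (kM' jk') ck' Mc' Mc1'.
have singM' jk' := cycle_trace_single k8 (kM' jk') ck' Mc' Mc1'.
clear kM kM' c ck Mc Mc1 c' ck' Mc' Mc1'; clearbody M M'.
have -> : cadj k i j = (i.+1 == j) || (j == k) && (i == 0) by rewrite /cadj /ladj; lia.
case: e Mi M'j => Mi M'j.
- apply/esym/negPn/negP => nij.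
  have [jk'|jk'] := ltnP j k; last first.
    have M0 : i != 0 -> M 0 by move=> i0; rewrite ME; lia.
    have Mk : M k.-1 by rewrite ME; lia.
    have := pairM i k.-1; have := pairM 0 i; rewrite Mi Mk.
    by move: M0; case: eqP => [|_ /(_ isT) ->]; lia.
  have Mj1 : M j.-1 by rewrite ME; lia.
  have := pairM i j.-1 ltac:(lia) ltac:(lia) Mi Mj1.
  have [j1k|j1k] := ltnP j.+1 k.
    have Mj2 : M j.+1 by rewrite ME; lia.
    by have := pairM i j.+1 ltac:(lia) ltac:(lia) Mi Mj2; lia.
  (* For [j = k - 1] the marks [k - 4] and [k - 2] are compatible, so the other trace is needed. *)
  move=> ji; have M'i1 : M' i.-1 by rewrite M'E; lia.
  by have := pairM' i.-1 j jk' ltac:(lia) ltac:(lia) M'i1 M'j; lia.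
- apply/esym/negP => /orP[/eqP ij1|/andP[/eqP ejk /eqP i0]]; last first.
    have Mk : M k.-1 by rewrite ME; lia.
    have [||b bk [Mb bE]] := singM k.-1 ltac:(lia) Mk; try lia.
    have [b0|b0] := eqVneq b i; first by rewrite b0 Mi in Mb.
    by move: Mb; rewrite ME //; case: bE; lia.
  have [jk'|jk'] := ltnP j k; last first.
    have M0 : M 0 by rewrite ME; lia.
    have [||b bk [Mb bE]] := singM 0 ltac:(lia) M0; try lia.
    have [b0|b0] := eqVneq b i; first by rewrite b0 Mi in Mb.
    by move: Mb; rewrite ME //; case: bE; lia.
  (* The lost mark [i] leaves [j + 1] alone, which is absurd unless it is off the path or equals
     [k - 2]. In those cases the other trace has the lone mark [i - 1]. *)
  have [j1k|j1k] := boolP ((j.+1 < k) && (j + 3 != k)).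
    have Mj : M j.+1 by rewrite ME; lia.
    have [||b bk [Mb bE]] := singM j.+1 ltac:(lia) Mj; try lia.
    have [b0|b0] := eqVneq b i; first by rewrite b0 Mi in Mb.
    by move: Mb; rewrite ME //; case: bE; lia.
  have M'i1 : M' i.-1 by rewrite M'E; lia.
  have [||b bk [Mb bE]] := singM' i.-1 jk' ltac:(lia) M'i1; try lia.
  have [b0|b0] := eqVneq b j; first by rewrite b0 M'j in Mb.
  by move: Mb; rewrite M'E //; case: bE; lia.
Qed.

(** * Induced paths in a graph with no triangle and no induced T123 *)

Section TriangleT123Free.
Variable G : sgraph.
Hypothesis G_tf : triangle_free G.
Hypothesis G_noT : ~ contains_induced G T123.
Implicit Types (u v w : G) (p q : nat -> G).

(** Only the values below [k] matter; from 4 vertices on, the adjacencies force injectivity. *)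
Definition ipath (k : nat) (p : nat -> G) : Prop :=
  forall i j, i < k -> j < k -> adj (p i) (p j) = ladj i j.

Lemma adj_common u v w : adj w u -> adj w v -> adj u v = false.
Proof.
move=> wu wv; apply/negP => uv; apply: G_tf; exists w, u, v; split=> //.
Qed.

(** No two vertices of T123 have the same neighbours, so [f] is injective on them. *)
Lemma no_T123_fun (f : nat -> G) :
  ~ (forall i j, i < 7 -> j < 7 -> adj (f i) (f j) = T123_nat i j).
Proof.
move=> fE; apply: G_noT; exists (fun i : T123 => f (i : 'I_7)); last first.
  by move=> i j; apply: fE; apply: ltn_ord.
move=> i j eq_f; have rows t : t < 7 -> T123_nat i t = T123_nat j t.
  by move=> t7; rewrite -!fE ?eq_f //; apply: ltn_ord.
apply/val_inj => /=; move: (rows 0 isT) (rows 1 isT) (rows 2 isT) (rows 3 isT)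
  (rows 4 isT) (rows 5 isT) (rows 6 isT).
case: i {eq_f rows} => i /=; case: j => j /=.
by do 7 (case: i => [|i] /=; first by do 7 (case: j => [|j] //=)).
Qed.

Lemma path1_no_T123 k p v t : ipath k p -> all (leq^~ k) t -> size t = 7 ->
  ~~ T123_at (path1_adj k (fun x => adj v (p x))) t.
Proof.
move=> kp /allP tk t7; apply/negP => /allP Tt.
pose q x := if x == k then v else p x.
apply: (@no_T123_fun (fun i => q (nth 0 t i))) => i j i7 j7.
have /allP Ti := Tt i ltac:(by rewrite mem_iota).
have /eqP <- := Ti j ltac:(by rewrite mem_iota).
have ik := tk (nth 0 t i) ltac:(by rewrite mem_nth ?t7).
have jk := tk (nth 0 t j) ltac:(by rewrite mem_nth ?t7).
rewrite /q /path1_adj; case: (eqVneq (nth 0 t i)) => ik'; case: (eqVneq (nth 0 t j)) => jk' //=.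
- by rewrite adj_irrefl.
- by rewrite adj_sym.
by rewrite kp //; lia.
Qed.

Lemma ipath_widen k p : ipath k.+1 p -> ipath k p.
Proof. by move=> kp i j ik jk; apply: kp; lia. Qed.

Lemma ipath_tail k p : ipath k.+1 p -> ipath k (fun x => p x.+1).
Proof. by move=> kp i j ik jk; rewrite kp. Qed.

(** Induction on the length: the base is the finite check on 8 vertices, and the step drops the last
    and the first vertex in turn. *)
Lemma path_good_trace k p v :
  8 <= k -> ipath k p -> good_trace k (fun x => adj v (p x)).
Proof.
elim: k p => // k IH p; rewrite leq_eqVlt => /orP[/eqP<- | k8] kp.
  apply: mask_clean_good; apply/andP; split.
    apply/allP => i; rewrite mem_iota => i7; apply/negP => /andP[vi vj].
    by have := adj_common vi vj; rewrite kp /ladj; lia.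
  have /allP wit : all (fun t => (size t == 7) && all (leq^~ 8) t) T123_witnesses by [].
  by apply/allP => t /wit /andP[/eqP t7 t8]; apply: path1_no_T123.
have k8' : 8 <= k by lia.
have all7 (P : pred nat) : P 0 -> P 1 -> P 2 -> P 3 -> P 4 -> P 5 -> P 6 -> all P (iota 0 7).
  by rewrite /= => -> -> -> -> -> -> ->.
have at_ext t : all (leq^~ k.+1) t ->
    forall M : pred nat, (forall x, x <= k -> adj v (p x) = M x) ->
  T123_at (path1_adj k.+1 M) t -> T123_at (path1_adj k.+1 (fun x => adj v (p x))) t.
  move=> /allP tk M vM /allP Tt; apply/allP => i i7; apply/allP => j j7.
  move/allP/(_ j j7)/eqP: (Tt i i7) => <-; apply/eqP; rewrite /path1_adj.
  have nk l : nth 0 t l <= k.+1.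
    by have [lt|lt] := ltnP l (size t); [apply/tk/mem_nth | rewrite nth_default].
  have := nk i; have := nk j; case: eqP => [ik|ik]; case: eqP => [jk|jk] //= jk' ik'; rewrite ?vM //; lia.
apply: good_trace_step => //.
- exact: IH (ipath_widen kp).
- exact: IH (ipath_tail kp).
- move=> x xk; apply/negP => /andP[vi vj].
  by have := adj_common vi vj; rewrite kp /ladj; lia.
(* [v], at index [k + 1], closes a hole through p_1, .., p_k with p_0 pendant at p_1; the hole is
   long enough for the other two arms of T123 around p_1. The next case is its mirror image. *)
- move=> vE; have tk : all (leq^~ k.+1) [:: 1; 0; 2; 3; k.+1; k; k.-1] by rewrite /=; lia.
  case/negP: (@path1_no_T123 _ _ v _ kp tk erefl).
  apply: (at_ext _ tk _ vE); rewrite /T123_at /path1_adj /ladj.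
  do 2! apply: (all7); 
    match goal with |- context [T123_nat ?i ?j] =>
      let b := eval vm_compute in (T123_nat i j) in change (T123_nat i j) with b
    end; rewrite /=; repeat case: ifP; lia.
- move=> vE; have tk : all (leq^~ k.+1) [:: k.-1; k; k.-2; k - 3; k.+1; 0; 1] by rewrite /=; lia.
  case/negP: (@path1_no_T123 _ _ v _ kp tk erefl).
  apply: (at_ext _ tk _ vE); rewrite /T123_at /path1_adj /ladj.
  do 2! apply: (all7); 
    match goal with |- context [T123_nat ?i ?j] =>
      let b := eval vm_compute in (T123_nat i j) in change (T123_nat i j) with b
    end; rewrite /=; repeat case: ifP; lia.
Qed.

(** * Exchanging vertices of a longest induced path *)

Section LongestPath.
Variable k : nat.
Hypothesis k8 : 8 <= k.
Hypothesis k_max : forall q : nat -> G, ~ ipath k.+1 q.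

Lemma ipath_cons m p v : ipath m p ->
    (forall x, x < m -> adj v (p x) = (x == 0)) ->
  ipath m.+1 (fun x => if x is y.+1 then p y else v).
Proof.
move=> mp vp [|i] [|j] im jm; rewrite ?adj_irrefl ?(adj_sym _ v) ?vp ?mp /ladj //; lia.
Qed.

Lemma ipath_rcons m p v : ipath m p ->
    (forall x, x < m -> adj v (p x) = (x.+1 == m)) ->
  ipath m.+1 (fun x => if x == m then v else p x).
Proof.
move=> mp vp i j im jm; case: eqP => [->|ii]; case: eqP => [->|jj];
  rewrite ?adj_irrefl ?(adj_sym _ v) ?vp ?mp /ladj //; lia.
Qed.

Definition upd p i v : nat -> G := fun x => if x == i then v else p x.

Lemma ipath_upd m p i v : ipath m p ->
  (forall x, x < m -> x != i -> adj v (p x) = ladj i x) -> ipath m (upd p i v).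
Proof.
move=> mp vp x y xm ym; rewrite /upd; case: eqP => xi; case: eqP => yi.
- by rewrite adj_irrefl /ladj; lia.
- by rewrite vp ?xi //; apply/eqP.
- by rewrite adj_sym vp /ladj //; lia.
- by rewrite mp.
Qed.

(** Maximality enters here: a vertex adjacent to exactly one end of the path, and to nothing else on
    it, would prolong it. *)
Lemma longest_trace p v : ipath k p -> cycle_trace k (fun x => adj v (p x)).
Proof.
move=> kp; case: (path_good_trace v k8 kp) => [[J h]|h|h]; last by constructor 3.
- have [J0|J0] := boolP ((J == 0) || (k + 3 <= J)).
    by constructor 1 => x xk; rewrite h // /twin_trace; lia.
  have [J1|J1] := eqVneq J 1.
    have vp x : x < k -> adj v (p x) = (x == 0) by move=> xk; rewrite h // /twin_trace; lia.
    by case: (k_max (ipath_cons kp vp)).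
  have [J2|J2] := eqVneq J (k + 2).
    have vp x : x < k -> adj v (p x) = (x.+1 == k) by move=> xk; rewrite h // /twin_trace; lia.
    by case: (k_max (ipath_rcons kp vp)).
  constructor 2; exists (J - 2); first by lia.
  by move=> x xk; rewrite h // /twin_trace /cadj /ladj; lia.
- by constructor 2; exists k => // x xk; rewrite h // /cadj /ladj; lia.
Qed.

Variable p : nat -> G.
Hypothesis kp : ipath k p.

Definition twins (i : nat) : {set G} :=
  [set v | [forall x : 'I_k, adj v (p x) == cadj k i x]].

Lemma twinsP i v :
  reflect (forall x, x < k -> adj v (p x) = cadj k i x) (v \in twins i).
Proof.
rewrite inE; apply: (iffP forallP) => [h x xk | h x]; last by rewrite h.
exact/eqP/(h (Ordinal xk)).
Qed.

Lemma mem_twins i : i < k -> p i \in twins i.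
Proof. by move=> ik; apply/twinsP => x xk; rewrite kp // /cadj; lia. Qed.

Lemma ipath_upd_twin i u : i < k -> u \in twins i -> ipath k (upd p i u).
Proof.
move=> ik /twinsP ui; apply: ipath_upd => // x xk xi; rewrite ui // /cadj; lia.
Qed.

Lemma upd_trace i u w : i < k -> u \in twins i ->
  cycle_trace k (fun x => if x == i then adj w u else adj w (p x)).
Proof.
move=> ik ui; have := longest_trace w (ipath_upd_twin ik ui).
have eqt x : adj w (upd p i u x) = if x == i then adj w u else adj w (p x).
  by rewrite /upd; case: ifP.
by case=> [h|[j jk h]|[b h]]; [constructor 1|constructor 2; exists j|constructor 3; exists b] => // x xk; rewrite -eqt h.
Qed.

Lemma cycle_trace_ext (M M' : pred nat) :
  (forall x, x < k -> M x = M' x) -> cycle_trace k M -> cycle_trace k M'.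
Proof.
by move=> e [h|[j jk h]|[b h]]; [constructor 1|constructor 2; exists j|constructor 3; exists b] => // x xk; rewrite -e // h.
Qed.

(** Within one class, a common neighbour on the path and the absence of triangles forbid adjacency;
    between classes, the exchange of [swap_trace] decides. *)
Lemma adj_twins i j u w : i <= k -> j <= k ->
  u \in twins i -> w \in twins j -> adj u w = cadj k i j.
Proof.
wlog ij : i j u w / i <= j.
  move=> H ik jk ui wj; have [ij|ji] := leqP i j; first exact: H.
  by rewrite adj_sym (H j i) // 1?ltnW // /cadj /ladj; lia.
move=> ik jk ui wj; have [eij|nij] := eqVneq i j.
  rewrite -{j}eij in jk ij wj *; have -> : cadj k i i = false by rewrite /cadj /ladj; lia.
  (* A cycle neighbour of [i] that lies on the path. *)
  pose t := if i is i'.+1 then i' else 1.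
  have tk : t < k by rewrite /t; case: (i) ik; lia.
  have it : cadj k i t by rewrite /t /cadj /ladj; case: (i); lia.
  by apply: (@adj_common _ _ (p t)); rewrite adj_sym; [move/twinsP: ui => ->|move/twinsP: wj => ->].
have {nij}ij : i < j by lia.
have ik' : i < k by lia.
apply: (swap_trace k8 ij jk).
  apply: cycle_trace_ext (upd_trace w ik' ui) => x xk.
  by case: ifP => _; [rewrite adj_sym | move/twinsP: wj => ->].
move=> jk'; apply: cycle_trace_ext (upd_trace u jk' wj) => x xk.
by case: ifP => // _; move/twinsP: ui => ->.
Qed.

Lemma twins_inj i j v : i <= k -> j <= k -> v \in twins i -> v \in twins j -> i = j.
Proof.
wlog ij : i j / i <= j.
  move=> H ik jk vi vj; have [ij|ji] := leqP i j; first exact: H.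
  by apply/esym/H => //; lia.
move=> ik jk /twinsP vi /twinsP vj; apply/eqP/negPn/negP => nij.
have e x : x < k -> cadj k i x = cadj k j x by move=> xk; rewrite -vi ?vj.
have {}e x : x < k -> cadj k i x -> cadj k j x by move=> xk; rewrite e.
have [i0|i0] := eqVneq i 0.
  have j2 : j = 2.
    have : cadj k j 1 by apply: e; [lia | rewrite /cadj /ladj i0].
    by clear -k8 i0 nij; rewrite /cadj /ladj; lia.
  have /negP[] : ~~ cadj k i 3 by clear -k8 i0; rewrite /cadj /ladj i0; lia.
  have k3 : 3 < k by lia.
  by rewrite -vi // vj // j2 /cadj /ladj.
(* For 0 < i < j, the vertex [i - 1] is adjacent to [j] only if [i = 1] and [j = k]; then 2
   separates them. *)
have : cadj k j i.-1 by apply: e; [lia | clear -i0; rewrite /cadj /ladj; lia].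
have [jk'|jk'] := eqVneq j k; last by clear -ij nij jk jk' i0; rewrite /cadj /ladj; lia.
have [i1|i1] := eqVneq i 1; last by clear -ij nij jk' i1 i0; rewrite /cadj /ladj; lia.
move=> _; have : cadj k j 2 by apply: e; [lia | rewrite /cadj /ladj i1].
by rewrite jk' /cadj /ladj; clear -k8; lia.
Qed.

Lemma single_trace i : i < k ->
  cycle_trace k (fun x => x == i) -> i = 1 \/ i.+2 = k.
Proof.
move=> ik ki; have [i1|i1] := eqVneq i 1; first by left.
right; apply/eqP/negPn/negP => /eqP i2; move/eqP: i1 => i1.
have [c ck [c0 c1]] : exists2 c, c.+1 < k & (c == i) = false /\ (c.+1 == i) = false.
  by have [i4|i4] := ltnP i 4; [exists 4 | exists 0]; try split; lia.
have [b bk [/eqP bi]] := cycle_trace_single k8 ki ck c0 c1 ik (eqxx i) i1 i2.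
by case; lia.
Qed.

Section Blank.
Variable v : G.
Hypothesis v_blank : forall x, x < k -> adj v (p x) = false.

(* A neighbour [w] of [v] at position 1 gives the longest path v, w, p_2, .., on which the trace of p_1 would be the single vertex p_2; position k - 2 is symmetric, and [w] in [twins k] gives the path w, p_0, .., p_(k - 2). *)
Lemma blank_twins i w : i <= k -> w \in twins i -> adj v w = false.
Proof.
move=> ik wi; apply/negP => vw; have wE := elimT (twinsP _ _) wi.
have [ik'|ik'] := ltnP i k; last first.
  have {ik ik'}ei : i = k by lia.
  pose q x := if x is y.+1 then p y else w.
  have kq : ipath k q.
    move=> [|x] [|y] xk yk; rewrite /q ?adj_irrefl ?(adj_sym _ w) ?wE ?kp ?ei /cadj /ladj; lia.
  suff /(single_trace (ltac:(lia) : 0 < k)) : cycle_trace k (fun x => x == 0) by lia.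
  apply: cycle_trace_ext (longest_trace v kq) => -[|x] xk; rewrite /q ?vw ?v_blank //; lia.
have : cycle_trace k (fun x => x == i).
  by apply: cycle_trace_ext (upd_trace v ik' wi) => x xk; case: ifP => // _; rewrite v_blank.
have pw x : x < k -> adj w (p x) = ladj i x by move=> xk; rewrite wE // /cadj; lia.
case/(single_trace ik') => [i1|i2].
- have kq : ipath k (upd (upd p 1 w) 0 v).
    apply: ipath_upd; first by apply: ipath_upd => // x xk _; rewrite pw // i1.
    move=> [|[|x]] xk //= _; rewrite /upd /= ?vw ?v_blank //.
  suff /(single_trace (ltac:(lia) : 2 < k)) : cycle_trace k (fun x => x == 2) by lia.
  apply: cycle_trace_ext (longest_trace (p 1) kq) => -[|[|x]] xk; rewrite /upd /=.
  + by rewrite adj_sym v_blank; lia.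
  + by rewrite adj_sym pw /ladj; lia.
  + by rewrite kp /ladj; lia.
- have kq : ipath k (upd (upd p i w) k.-1 v).
    apply: ipath_upd; first by apply: ipath_upd => // x xk _; rewrite pw.
    move=> x xk xk1; rewrite /upd; case: eqP => [->|xi]; first by rewrite vw /ladj; lia.
    by rewrite v_blank // /ladj; lia.
  suff /(single_trace (ltac:(lia) : k - 3 < k)) : cycle_trace k (fun x => x == k - 3) by lia.
  apply: cycle_trace_ext (longest_trace (p i) kq) => x xk; rewrite /upd /=; case: eqP => [->|xk1].
    by rewrite adj_sym v_blank; lia.
  case: eqP => [->|xi]; first by rewrite adj_sym pw /ladj; lia.
  by rewrite kp /ladj; lia.
Qed.

End Blank.

Section Alternating.
Variables (v : G) (b : bool).
Hypothesis v_alt : forall x, x < k -> adj v (p x) = (odd x == b).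

Lemma alternating_twins i w : i < k -> w \in twins i -> adj v w = (odd i == b).
Proof.
move=> ik wi; have := upd_trace v ik wi; set M := fun x => _ => kM.
have Mi : M i = adj v w by rewrite /M eqxx.
have ME x : x < k -> x != i -> M x = (odd x == b).
  by move=> xk /negPf xi; rewrite /M xi v_alt.
suff [b' h] : exists b', forall x, x < k -> M x = (odd x == b').
  have -> : b = b'; last by rewrite -Mi h.
  have [t tk ti] : exists2 t, t < k & t != i.
    by have [->|i0] := eqVneq i 0; [exists 1; lia | exists 0; lia].
  by have := h t tk; rewrite ME //; case: (odd t); case: (b); case: (b').
(* One of the pairs [b], [b + 4] and [b + 2], [b + 6] avoids [i]. *)
clearbody M; have [ib|ib] := boolP ((i == b) || (i == b + 4)).
  by apply: (cycle_trace_parity k8 kM (a := b + 2)); rewrite ?ME; case: (b) ib; lia.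
by apply: (cycle_trace_parity k8 kM (a := b)); rewrite ?ME; case: (b) ib; lia.
Qed.

(** Both w, p_0, .., p_(k - 2) and p_1, .., p_(k - 1), w are longest paths, and [v] alternates on
    each. Comparing the two values at w makes [k] odd. *)
Lemma alternating_last w : w \in twins k -> odd k /\ adj v w = (odd k == b).
Proof.
move=> wk; have wE := elimT (twinsP _ _) wk.
pose q x := if x is y.+1 then p y else w.
have kq : ipath k q.
  move=> [|x] [|y] xk yk; rewrite /q ?adj_irrefl ?(adj_sym _ w) ?wE ?kp /cadj /ladj; lia.
pose q' x := if x.+1 == k then w else p x.+1.
have kq' : ipath k q'.
  move=> x y xk yk; rewrite /q'; case: eqP => ex; case: eqP => ey;
    rewrite ?adj_irrefl ?(adj_sym _ w) ?wE ?kp /cadj /ladj; lia.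
have [b1 h1] : exists b1, forall x, x < k -> adj v (q x) = (odd x == b1).
  by apply: (cycle_trace_parity k8 (longest_trace v kq) (a := b.+1)); rewrite /= ?v_alt; case: (b); lia.
have q'E x : x.+1 < k -> adj v (q' x) = (odd x.+1 == b).
  by move=> xk; rewrite /q' ifF ?v_alt //; lia.
have [b2 h2] : exists b2, forall x, x < k -> adj v (q' x) = (odd x == b2).
  by apply: (cycle_trace_parity k8 (longest_trace v kq') (a := ~~ b));
    rewrite ?q'E; case: (b); lia.
have bb1 : b1 = ~~ b by have := h1 1; rewrite /= v_alt; case: (b); case: (b1); lia.
have bb2 : b2 = ~~ b.
  by have := h2 0 ltac:(lia); rewrite q'E; [case: (b); case: (b2) | lia].
have e1 := h1 0 ltac:(lia); have := h2 k.-1 ltac:(lia).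
rewrite /q' prednK ?eqxx => [e2|]; last by lia.
rewrite /= bb1 in e1; rewrite bb2 in e2.
have {}e2 : adj v w = (odd k == b) by rewrite e2; clear -k8; case: (b); lia.
by split; rewrite // -[odd k]eqb_id -?e2; move: e2; rewrite e1; case: (b); case: odd.
Qed.

End Alternating.

(** * The two outcomes: a bipartite 2-join or an extension of a cycle *)

Definition side (b : bool) : {set G} := \bigcup_(i < k.+1 | odd i == b) twins i.

Lemma sideP b v :
  reflect (exists2 i, i <= k & odd i = b /\ v \in twins i) (v \in side b).
Proof.
apply: (iffP bigcupP) => [[i /eqP ib vi]|[i ik [ib vi]]].
  by exists i; [rewrite -ltnS; apply: ltn_ord | ].
by exists (Ordinal (ik : i < k.+1)); rewrite //= ib.
Qed.

Lemma trace_outside v : v \notin side false -> v \notin side true ->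
  (forall x, x < k -> adj v (p x) = false) \/
  exists b, forall x, x < k -> adj v (p x) = (odd x == b).
Proof.
move=> v0 v1; case: (longest_trace v kp) => [h|[j jk h]|h]; [by left| |by right].
have vj : v \in twins j by apply/twinsP.
by case/negP: (if odd j as b return v \notin side b then v1 else v0); apply/sideP; exists j.
Qed.

Lemma two_join_of_alternating v b :
  (forall x, x < k -> adj v (p x) = (odd x == b)) -> has_bipartite_two_join G.
Proof.
move=> v_alt.
(* If S_k is nonempty then [k] is odd, so the cycle edge between 0 and [k] also joins opposite
   sides. *)
have par i w : i <= k -> w \in twins i -> i = k -> odd k.
  by move=> ik wi ei; rewrite ei in wi; have [] := alternating_last v_alt wi.
have stab c : stable (side c).
  move=> u w /sideP[i ik [ic ui]] /sideP[j jk [jc wj]].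
  rewrite (adj_twins ik jk ui wj) /cadj /ladj.
  have pi := par i u ik ui; have pj := par j w jk wj.
  apply/negP => /or3P[/orP[]/eqP e|/andP[/eqP e /eqP e']|/andP[/eqP e /eqP e']].
  - by rewrite -e /= ic in jc; case: (c) jc.
  - by rewrite -e /= jc in ic; case: (c) ic.
  - by rewrite e' /= in jc; have := pi e; rewrite -e ic -jc.
  - by rewrite e' /= in ic; have := pj e; rewrite -e jc -ic.
have sidep i : i < k -> p i \in side (odd i).
  by move=> ik; apply/sideP; exists i; [lia | split=> //; apply: mem_twins].
have disj u : u \in side false -> u \in side true -> False.
  move=> /sideP[i ik [ic ui]] /sideP[j jk [jc wj]].
  by rewrite (twins_inj ik jk ui wj) jc in ic.
(* A vertex outside all S_i treats each side uniformly, so one path vertex of that side decides. *)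
have compl u c w x : x < k -> u \notin side false -> u \notin side true -> w \in side c ->
    c = odd x -> adj u w = adj u (p x).
  move=> xk u0 u1 /sideP[i ik [ic wi]] cx; case: (trace_outside u0 u1) => [h|[b' h]].
    by rewrite (blank_twins h ik wi) h.
  rewrite h // -cx -ic; have [ik'|ik'] := ltnP i k; first exact: alternating_twins h _ _ ik' wi.
  have ei : i = k by lia.
  by rewrite ei in wi *; have [] := alternating_last h wi.
pose X2 := side false :|: side true.
have outX u : u \in ~: X2 -> u \notin side false /\ u \notin side true.
  by rewrite !inE negb_or => /andP.
exists (~: X2), X2, [set u in ~: X2 | adj u (p 0)], [set u in ~: X2 | adj u (p 1)], (side false), (side true).
have v_out : v \in ~: X2.
  rewrite inE; apply/negP; rewrite inE => /orP vs.
  have [c [i ik [_ /twinsP vi]]] : exists c, exists2 i, i <= k & odd i = c /\ v \in twins i.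
    by case: vs => /sideP; [exists false | exists true].
  (* The marks [b] and [b + 4] of [v] have no common neighbour on the cycle. *)
  clear -v_alt vi k8; have bk : b + 4 < k by case: (b); lia.
  have : cadj k i b by rewrite -vi ?v_alt; [case: (b) | lia | lia].
  have : cadj k i (b + 4) by rewrite -vi ?v_alt; [case: (b) | lia | lia].
  rewrite /cadj /ladj => i4 ib.
  have {i4}i4 : i = b + 3 \/ i = b + 5 by clear -i4 bk; lia.
  have {ib}ib : i <= b + 1 \/ i = k /\ b = 0 :> nat by clear -ib; lia.
  by clear -i4 ib k8; lia.
split=> //.
- have [k0 k1] : 0 < k /\ 1 < k by lia.
  split.
  + by rewrite setUC setUCr.
  + by rewrite disjoint_sym -setI_eq0 setICr.
  + by apply/subsetP => u; rewrite !inE => /andP[].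
  + by apply/subsetP => u; rewrite !inE => /andP[].
  + apply/pred0P => u /=; apply/negP; rewrite !inE => /andP[/andP[_ u0] /andP[_ u1]].
    by have := adj_common u0 u1; rewrite kp /ladj; lia.
  + exact: subsetUl.
  + exact: subsetUr.
  + by apply/pred0P => u /=; apply/negP => /andP[]; apply: disj.
  + move=> u w; rewrite inE => /andP[/outX[u0 u1] up] ws.
    by rewrite (compl u false w 0 k0 u0 u1 ws erefl).
  + move=> u w; rewrite inE => /andP[/outX[u0 u1] up] ws.
    by rewrite (compl u true w 1 k1 u0 u1 ws erefl).
  + move=> u w uX wX uw; have [u0 u1] := outX _ uX.
    case/setUP: wX => ws; [left | right]; split=> //; rewrite inE uX /=.
      by rewrite -(compl u false w 0 k0 u0 u1 ws erefl).
    by rewrite -(compl u true w 1 k1 u0 u1 ws erefl).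
- apply/set0Pn; exists v; apply/setUP.
  by case eb: b; [right | left]; rewrite inE v_out /= v_alt ?eb //; lia.
- by apply/set0Pn; exists (p 0); apply: (sidep 0); lia.
- by apply/set0Pn; exists (p 1); apply: (sidep 1); lia.
- have inX i : i < k -> p i \in X2.
    by move=> ik; rewrite inE; have := sidep i ik; case: (odd i) => ->; rewrite ?orbT.
  have ne i j : i <= k -> i < j -> j < k -> p i != p j.
    move=> ik ij jk; apply/eqP => e.
    have ii := mem_twins (ltac:(lia) : i < k).
    have := mem_twins jk; rewrite -e => jj.
    by have := twins_inj ik (ltnW jk) ii jj; lia.
  have: #|[set p 0; p 1; p 2]| <= #|X2|.
    by apply/subset_leq_card/subsetP => u; rewrite !inE -!orbA => /or3P[] /eqP->;
      rewrite -in_setU; apply: inX; lia.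
  apply: leq_trans; rewrite setUC cardsU1 cards2 !inE negb_or.
  by rewrite (ne 0 1) ?(eq_sym (p 2)) ?ne //; lia.
- exists (p 0), (p 1); rewrite !inE (sidep 0) ?(sidep 1) ?orbT ?kp //; lia.
Qed.

Lemma extension_of_no_alternating : connected G ->
    (forall v b, ~ forall x, x < k -> adj v (p x) = (odd x == b)) ->
  is_extension_of G (cycle_graph k.+1).
Proof.
move=> G_conn no_alt; pose V := side false :|: side true.
have VP v : reflect (exists2 i, i <= k & v \in twins i) (v \in V).
  apply: (iffP setUP) => [[] /sideP[i ik [_ vi]]|[i ik vi]]; try by exists i.
  by case ei: (odd i); [right | left]; apply/sideP; exists i.
have outV v : v \notin V -> forall x, x < k -> adj v (p x) = false.
  rewrite in_setU negb_or => /andP[v0 v1].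
  by case: (trace_outside v0 v1) => // -[b /no_alt].
(* A vertex outside [V] has an empty trace, hence no neighbour in [V]. *)
have closedV u w : adj u w -> u \in V -> w \in V.
  move=> uw /VP[i ik ui]; apply/negPn/negP => /outV w0.
  by move: uw; rewrite adj_sym (blank_twins w0 ik ui).
have allV v : v \in V.
  have p0V : p 0 \in V by apply/VP; exists 0; [lia | apply: (mem_twins); lia].
  have /connectP[s] := G_conn (p 0) v.
  elim: s (p 0) p0V => [x xV _ -> //|y s IH x xV /= /andP[xy ys] ev].
  exact: (IH y (closedV _ _ xy xV) ys ev).
have ordk (i : 'I_k.+1) : i <= k by have := ltn_ord i.
have adjE (i j : 'I_k.+1) u w : u \in twins i -> w \in twins j -> adj u w = cycle_adj i j.
  by move=> ui wj; rewrite (adj_twins _ _ ui wj) // cycle_adjE //; lia.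
exists (fun i : 'I_k.+1 => twins i); split.
- apply/setP => v; rewrite inE; apply/bigcupP.
  by have /VP[i ik vi] := allV v; exists (Ordinal (ik : i < k.+1)).
- move=> i j ij; apply/pred0P => v /=; apply/negP => /andP[vi vj].
  by case/eqP: ij; apply/val_inj/(twins_inj _ _ vi vj); apply: ordk.
- by move=> i u w ui wi; rewrite (adjE i i) // /cycle_adj eqxx.
- by move=> i j ij u w ui wj; rewrite (adjE i j).
- by move=> i j _ ij u w ui wj; rewrite (adjE i j).
Qed.

End LongestPath.

(** * Existence of a longest induced path *)

Definition has_ipath (m : nat) : bool :=
  [exists t : m.-tuple G, [forall i : 'I_m, [forall j : 'I_m, adj (tnth t i) (tnth t j) == ladj i j]]].

Lemma has_ipathP m : 0 < m -> reflect (exists p : nat -> G, ipath m p) (has_ipath m).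
Proof.
move=> m0; apply: (iffP existsP) => [[t /forallP ht]|[p mp]].
  have x0 := tnth t (Ordinal m0); exists (nth x0 t) => i j im jm.
  have /forallP/(_ (Ordinal jm))/eqP := ht (Ordinal im).
  by rewrite !(tnth_nth x0).
exists [tuple p i | i < m]; apply/forallP => i; apply/forallP => j.
by rewrite !tnth_mktuple mp.
Qed.

(** Distinct vertices of a path on at least 4 vertices have distinct neighbourhoods, so [p] is
    injective; this bounds the length in the choice of a longest path. *)
Lemma ipath_leq_card m p : 4 <= m -> ipath m p -> m <= #|G|.
Proof.
move=> m4 mp; rewrite -[m in m <= _]card_ord; apply: (@leq_card _ _ (fun i : 'I_m => p i)).
suff lt_neq (i j : 'I_m) : i < j -> p i <> p j.
  move=> i j eij; apply/val_inj => /=.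
  by case: (ltngtP i j) => // /lt_neq []; rewrite eij.
move=> ij e; have jm := ltn_ord j.
have L x : x < m -> ladj i x = ladj j x by move=> xm; rewrite -!mp // e.
have [i0|i0] := eqVneq (i : nat) 0.
  by move: (L 1 ltac:(lia)) (L 3 ltac:(lia)); rewrite /ladj; lia.
by move: (L i.-1 ltac:(lia)); rewrite /ladj; lia.
Qed.

End TriangleT123Free.

Theorem mainTheorem7 (G : sgraph) :
  connected G -> triangle_free G -> ~ contains_induced G T123 ->
  [\/ ~ contains_induced G (path_graph 8),
      (exists2 n : nat, 3 <= n & is_extension_of G (cycle_graph n)) \/
      (exists2 n : nat, 1 <= n & is_extension_of G (path_graph n))
    | has_bipartite_two_join G].
Proof.
move=> G_conn G_tf G_noT; have [P8|noP8] := boolP (has_ipath G 8); last first.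
  constructor 1 => -[f _ fE]; case/has_ipathP: noP8 => //.
  by exists (fun x => f (inord x)) => i j i8 j8; rewrite fE /= /path_adj !inordK.
pose P m := (8 <= m) && has_ipath G m.
have exP : exists m, P m by exists 8.
have ubP m : P m -> m <= #|G|.
  case/andP=> m8 /has_ipathP[|q mq]; first by lia.
  by apply: ipath_leq_card mq; lia.
case: (ex_maxnP exP ubP) => k /andP[k8 hk] maxk.
have [p kp] : exists p : nat -> G, ipath k p by apply/has_ipathP => //; lia.
have k_max (q : nat -> G) : ~ ipath k.+1 q.
  move=> kq; have := maxk k.+1; rewrite /P (introT (has_ipathP _ _)) //; [lia | by exists q].
pose alt v b := [forall x : 'I_k, adj v (p x) == (odd x == b)].
have altP v b : reflect (forall x, x < k -> adj v (p x) = (odd x == b)) (alt v b).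
  by apply: (iffP forallP) => [h x xk|h x]; [exact/eqP/(h (Ordinal xk)) | rewrite h].
have [/existsP[v /existsP[b /altP v_alt]]|no_alt] := boolP [exists v, exists b, alt v b].
  by constructor 3; apply: (@two_join_of_alternating G G_tf G_noT k k8 k_max p kp v b v_alt).
constructor 2; left; exists k.+1; first by lia.
apply: (@extension_of_no_alternating G G_tf G_noT k k8 k_max p kp G_conn) => v b /altP v_alt.
by case/negP: no_alt; apply/existsP; exists v; apply/existsP; exists b.
Qed.
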